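(* The set $\widetilde Q = \{\tau\in C(\partial M) : M\setminus M^0(\tau)\ne\emptyset\}$ is the closure of $Q(M) = \{\tau\in C(\partial M) : m_\tau<m_\infty\}$ in $C(\partial M)$.
   Context: $(M,g)$ is a $C^\infty$-smooth, compact and connected Riemannian manifold of dimension $n\ge 2$ with nonempty boundary $\partial M$ and Riemannian distance $d$. $\mu$ is a $C^\infty$-smooth strictly positive function on $M$ and $m$ is the measure on $M$ given by $dm=\mu\,dV_g$, where $V_g$ is the Riemannian volume measure. $C(\partial M)$ is the space of real valued continuous functions on $\partial M$ with the sup norm topology. For $\tau\in C(\partial M)$, $$M(\partial M,\tau)=\{x\in M:\text{there is } y\in\partial M\text{ such that } d(x,y)\le\tau(y)\},$$ $$M^0(\tau)=\{x\in M:\text{there is } y\in\partial M\text{ such that } d(x,y)<\tau(y)\},$$ $m_\tau=m(M(\partial M,\tau))$ and $m_\infty=m(M)$. *)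

(* Defs.v *)
From HB Require Import structures.
From mathcomp Require Import all_boot all_order all_algebra.
From mathcomp Require Import all_classical all_reals all_analysis.
Set Implicit Arguments. Unset Strict Implicit. Unset Printing Implicit Defensive.
Import Order.TTheory GRing.Theory Num.Theory numFieldNormedType.Exports.
Local Open Scope classical_set_scope.
Local Open Scope ring_scope.

Section lebesgue_tuple.
Variable R : realType.

Section cons.
Variables (n : nat) (nu : {sigma_finite_measure set (n.-tuple R) -> \bar R}).

Definition cons_pair (p : measurableTypeR R * n.-tuple R) : n.+1.-tuple R :=
  [tuple of p.1 :: p.2].

Lemma measurable_cons_pair : measurable_fun setT cons_pair.
Proof. exact: measurable_cons. Qed.

Lemma measurable_preimage_cons_pair A :
  measurable A -> measurable (cons_pair @^-1` A).
Proof.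
by move=> mA; rewrite -[X in measurable X]setTI; exact: measurable_cons_pair.
Qed.

Definition lebesgue_cons : set (n.+1.-tuple R) -> \bar R :=
  pushforward (@lebesgue_measure R \x nu)%E cons_pair.

Let lebesgue_cons0 : lebesgue_cons set0 = 0%E.
Proof. by rewrite /lebesgue_cons /pushforward preimage_set0 measure0. Qed.

Let lebesgue_cons_ge0 A : (0 <= lebesgue_cons A)%E.
Proof. by rewrite /lebesgue_cons /pushforward measure_ge0. Qed.

Let lebesgue_cons_sigma_additive : semi_sigma_additive lebesgue_cons.
Proof.
move=> F mF tF mUF; rewrite /lebesgue_cons /pushforward preimage_bigcup.
apply: measure_semi_sigma_additive.
- by move=> i; exact: measurable_preimage_cons_pair.
- apply/trivIsetP => /= i j _ _ ij; rewrite -preimage_setI.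
  by move/trivIsetP : tF => /(_ _ _ _ _ ij) ->//; rewrite preimage_set0.
- by rewrite -preimage_bigcup; exact: measurable_preimage_cons_pair.
Qed.

HB.instance Definition _ := isMeasure.Build _ _ _ lebesgue_cons
  lebesgue_cons0 lebesgue_cons_ge0 lebesgue_cons_sigma_additive.

Let lebesgue_cons_sigma_finite : sigma_finite setT lebesgue_cons.
Proof.
have /sigma_finiteP[F [UF ndF Foo]] := sigma_finiteT (@lebesgue_measure R).
have /sigma_finiteP[G [UG ndG Goo]] := sigma_finiteT nu.
exists (fun i => [set t | F i (thead t) /\ G i [tuple of behead t]]).
  apply/seteqP; split => // t _.
  have [i _ Fi] : (\bigcup_i F i) (thead t) by rewrite -UF.
  have [j _ Gj] : (\bigcup_i G i) [tuple of behead t] by rewrite -UG.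
  exists (maxn i j) => //; split.
    by move: Fi; exact/subsetPset/ndF/leq_maxl.
  by move: Gj; exact/subsetPset/ndG/leq_maxr.
move=> i; have [mF Flty] := Foo i; have [mG Glty] := Goo i; split.
  apply: measurableI.
    by rewrite -[X in measurable X]setTI; exact: measurable_tnth.
  by rewrite -[X in measurable X]setTI; exact: measurable_behead.
rewrite /lebesgue_cons /pushforward.
rewrite (_ : cons_pair @^-1` _ = F i `*` G i); last first.
  apply/seteqP; split => -[x t] /=; rewrite /cons_pair/= theadE;
    by rewrite (_ : [tuple of behead [tuple of x :: t]] = t)//; exact: val_inj.
by rewrite product_measure1E// lte_mul_pinfty// ge0_fin_numE.
Qed.

HB.instance Definition _ := Measure_isSigmaFinite.Build _ _ _ lebesgue_cons
  lebesgue_cons_sigma_finite.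
End cons.

Fixpoint lebesgue_tuple n : {sigma_finite_measure set (n.-tuple R) -> \bar R} :=
  match n with
  | 0 => \d_[tuple]
  | n'.+1 => lebesgue_cons (lebesgue_tuple n')
  end.

Lemma measurable_tuple_box n (A : 'I_n -> set R) :
  (forall i, measurable (A i)) ->
  measurable [set t : n.-tuple R | forall i, A i (tnth t i)].
Proof.
move=> mA.
rewrite (_ : [set t | _] = \bigcap_i ((@tnth n R)^~ i @^-1` A i)); last first.
  by apply/seteqP; split => t At i; [move=> _; exact: At|exact: (At i I)].
apply: fin_bigcap_measurable => // i _.
by rewrite -[X in measurable X]setTI; exact: measurable_tnth.
Qed.

Lemma lebesgue_tuple_box n (A : 'I_n -> set R) :
  (forall i, measurable (A i)) ->
  lebesgue_tuple n [set t | forall i, A i (tnth t i)] =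
  (\prod_(i < n) lebesgue_measure (A i))%E.
Proof.
elim: n A => [|n IH] A mA.
  by rewrite big_ord0 /= diracE mem_set// => -[].
pose B : set (n.-tuple R) := [set t | forall i, A (lift ord0 i) (tnth t i)].
have mB : measurable B.
  by apply: (@measurable_tuple_box n (A \o lift ord0)) => i; exact: mA.
rewrite big_ord_recl -(IH (A \o lift ord0)); last by move=> i; exact: mA.
transitivity ((@lebesgue_measure R \x lebesgue_tuple n)%E (A ord0 `*` B)); last first.
  exact: (@product_measure1E _ _ _ _ _ (@lebesgue_measure R) (lebesgue_tuple n)
    _ _ (mA ord0) mB).
rewrite /= /lebesgue_cons /pushforward; congr (product_measure1 _ _ _).
apply/seteqP; split => -[x t]/=.
  move=> At; split; first exact: (At ord0).
  by move=> i; have := At (lift ord0 i); rewrite /cons_pair/= tnthS.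
move=> [Ax At] i; case: (unliftP ord0 i) => [j|] ->; last exact: Ax.
by rewrite /cons_pair/= tnthS.
Qed.

Section lebesgue_rV.
Variable n : nat.

Definition borel_rV := g_sigma_algebraType (@open 'rV[R]_n).

Definition row_of_tuple (t : n.-tuple R) : borel_rV := \row_i tnth t i.

Lemma measurable_row_of_tuple : measurable_fun setT row_of_tuple.
Proof.
apply: (@measurability _ _ _ _ _ row_of_tuple (@open 'rV[R]_n) erefl).
move=> _ [U oU <-]; rewrite setTI.
pose box (p : 'rV[rat]_n * 'rV[rat]_n) : set 'rV[R]_n :=
  [set v | forall i, v 0 i \in `]ratr (p.1 0 i), ratr (p.2 0 i)[ ].
have -> : U = \bigcup_(p in [set p | box p `<=` U]) box p.
  apply/seteqP; split; last by move=> v [p pU]; exact: pU.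
  move=> v Uv.
  have /nbhs_ballP[e /= e0 veU] : nbhs v U by exact: open_nbhs_nbhs.
  have /choice[a va] (i : 'I_n) : exists q, ratr q \in `](v 0 i - e), (v 0 i)[.
    have /rat_in_itvoo[q vq] : v 0 i - e < v 0 i by rewrite ltrBlDr ltrDl.
    by exists q.
  have /choice[b vb] (i : 'I_n) : exists q, ratr q \in `](v 0 i), (v 0 i + e)[.
    have /rat_in_itvoo[q vq] : v 0 i < v 0 i + e by rewrite ltrDl.
    by exists q.
  exists (\row_i a i, \row_i b i) => /=; last first.
    move=> i; rewrite !mxE in_itv /=.
    by rewrite (itvP (va i)) (itvP (vb i)).
  move=> w /= ab; apply: veU; split => // j i.
  rewrite (ord1 j) /ball /= ltr_distlC.
  have := ab i; rewrite !mxE in_itv/= => /andP[aw wb].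
  rewrite (lt_trans _ aw) ?(itvP (va i))//=.
  by rewrite (lt_trans wb)// (itvP (vb i)).
rewrite preimage_bigcup bigcup_mkcond.
apply: countable_bigcupT_measurable => [|p]; first exact: countableP.
case: ifP => // _.
rewrite (_ : row_of_tuple @^-1` box p =
   [set t | forall i, [set` `]ratr (p.1 0 i), ratr (p.2 0 i)[ ] (tnth t i)]).
  apply: (@measurable_tuple_box n
    (fun i => [set` `]ratr (p.1 0 i), ratr (p.2 0 i)[ ])) => i.
  exact: measurable_itv.
by apply/seteqP; split => t /= + i => /(_ i); rewrite mxE.
Qed.

Lemma measurable_preimage_row_of_tuple A :
  measurable A -> measurable (row_of_tuple @^-1` A).
Proof.
by move=> mA; rewrite -[X in measurable X]setTI; exact: measurable_row_of_tuple.
Qed.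

(* The [n]-dimensional Lebesgue measure on the Borel sets of ['rV[R]_n]; see
   [lebesgue_rV_box]. *)
Definition lebesgue_rV : set borel_rV -> \bar R :=
  pushforward (lebesgue_tuple n) row_of_tuple.

Let lebesgue_rV0 : lebesgue_rV set0 = 0%E.
Proof. by rewrite /lebesgue_rV /pushforward preimage_set0 measure0. Qed.

Let lebesgue_rV_ge0 A : (0 <= lebesgue_rV A)%E.
Proof. by rewrite /lebesgue_rV /pushforward measure_ge0. Qed.

Let lebesgue_rV_sigma_additive : semi_sigma_additive lebesgue_rV.
Proof.
move=> F mF tF mUF; rewrite /lebesgue_rV /pushforward preimage_bigcup.
apply: measure_semi_sigma_additive.
- by move=> i; exact: measurable_preimage_row_of_tuple.
- apply/trivIsetP => /= i j _ _ ij; rewrite -preimage_setI.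
  by move/trivIsetP : tF => /(_ _ _ _ _ ij) ->//; rewrite preimage_set0.
- by rewrite -preimage_bigcup; exact: measurable_preimage_row_of_tuple.
Qed.

HB.instance Definition _ := isMeasure.Build _ _ _ lebesgue_rV
  lebesgue_rV0 lebesgue_rV_ge0 lebesgue_rV_sigma_additive.

Lemma lebesgue_rV_box (A : 'I_n -> set R) :
  (forall i, measurable (A i)) ->
  lebesgue_rV [set v : 'rV[R]_n | forall i, A i (v 0 i)] =
  (\prod_(i < n) lebesgue_measure (A i))%E.
Proof.
move=> mA; rewrite -lebesgue_tuple_box//; congr (lebesgue_tuple n _).
by apply/seteqP; split => t /= + i => /(_ i); rewrite mxE.
Qed.

End lebesgue_rV.

End lebesgue_tuple.

Section smooth.
Variables (R : realType) (E F : normedModType R).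

(* Meant for [U] open and [E] finite dimensional, where quantifying over all
   directions [v] amounts to quantifying over the coordinate directions. *)
Fixpoint class_C k (U : set E) (f : E -> F) : Prop :=
  match k with
  | 0 => forall x, U x -> {for x, continuous f}
  | k'.+1 => (forall x, U x -> differentiable f x) /\
             forall v, class_C k' U ('D_v f)
  end.

Definition smooth_ext (D : set E) (f : E -> F) (x : E) (U : set E)
    (g : E -> F) : Prop :=
  [/\ open U, U x, (forall k, class_C k U g) &
      forall y, D y -> U y -> f y = g y].

(* Smoothness on a set which need not be open: existence of local smooth
   extensions. *)
Definition smooth_on (D : set E) (f : E -> F) : Prop :=
  forall x, D x -> exists U g, smooth_ext D f x U g.

End smooth.

Section manifold.
Variables (R : realType) (n : nat) (M : ptopologicalType).

(* The condition bears on the first coordinate only; [n] is positive in all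
   uses. *)
Definition half_space : set 'rV[R]_n :=
  [set x | forall i : 'I_n, val i = 0%N -> 0 <= x 0 i].

(* A homeomorphism from an open subset of [M] to a relatively open subset of
   the half space; [chart_map] and [chart_inv] are unconstrained outside of
   these sets. *)
Record chart := Chart {
  chart_dom : set M ;
  chart_map :> M -> 'rV[R]_n ;
  chart_inv : 'rV[R]_n -> M ;
  chart_dom_open : open chart_dom ;
  chart_image_open :
    exists2 U, open U & chart_map @` chart_dom = half_space `&` U ;
  chart_mapK : forall p, chart_dom p -> chart_inv (chart_map p) = p ;
  chart_map_continuous : {within chart_dom, continuous chart_map} ;
  chart_inv_continuous :
    {within chart_map @` chart_dom, continuous chart_inv}
}.

Definition chart_overlap (c c' : chart) : set 'rV[R]_n :=
  c @` (chart_dom c `&` chart_dom c').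

Definition transition (c c' : chart) : 'rV[R]_n -> 'rV[R]_n :=
  c' \o chart_inv c.

Record smooth_manifold := SmoothManifold {
  atlas : set chart ;
  atlas_cover : forall p, exists2 c, atlas c & chart_dom c p ;
  atlas_compatible : forall c c', atlas c -> atlas c' ->
    smooth_on (chart_overlap c c') (transition c c') ;
  manifold_hausdorff : hausdorff_space M ;
  manifold_second_countable : @second_countable M
}.

Variable X : smooth_manifold.

Definition chart_at (p : M) : chart := sval (cid2 (atlas_cover X p)).

Definition smooth_function (f : M -> R^o) : Prop :=
  forall c, atlas X c -> smooth_on (c @` chart_dom c) (f \o chart_inv c).

(* Complement of the set of the points that some chart sends to the interior of
   the half space; the choice between "some chart" and "every chart" is
   immaterial by invariance of the boundary under transition maps. *)
Definition boundary : set M :=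
  [set p | forall c, atlas X c -> chart_dom c p ->
     forall i : 'I_n, val i = 0%N -> c p 0 i = 0].

(* [metric c p] is the Gram matrix at [p] of the coordinate vector fields of
   the chart [c]; tangent vectors are row vectors, so that a change of charts
   acts on them by right multiplication by the Jacobian matrix ['J]. At boundary
   points the Jacobian matrix does not depend on the smooth extension. *)
Record riemannian_metric := RiemannianMetric {
  metric : chart -> M -> 'M[R]_n ;
  metric_smooth : forall c, atlas X c ->
    smooth_on (c @` chart_dom c) (metric c \o chart_inv c) ;
  metric_sym : forall c p, atlas X c -> chart_dom c p ->
    (metric c p)^T = metric c p ;
  metric_posdef : forall c p, atlas X c -> chart_dom c p ->
    forall v : 'rV[R]_n, v != 0 -> 0 < (v *m metric c p *m v^T) 0 0 ;
  metric_change : forall c c' p U T, atlas X c -> atlas X c' ->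
    chart_dom c p -> chart_dom c' p ->
    smooth_ext (chart_overlap c c') (transition c c') (c p) U T ->
    metric c p = 'J T (c p) *m metric c' p *m ('J T (c p))^T
}.

Variable g : riemannian_metric.

Definition smooth_arc (gamma : R -> M) (a b : R) : Prop :=
  forall c, atlas X c ->
    smooth_on (E := R^o) [set t | a <= t <= b /\ chart_dom c (gamma t)]
      (c \o gamma).

Definition piecewise_smooth_path (x y : M) (gamma : R -> M) : Prop :=
  [/\ {within `[0, 1], continuous gamma}, gamma 0 = x, gamma 1 = y &
      exists s : seq R, [/\ path <%R 0 s, last 0 s = 1 &
        forall i, (i < size s)%N -> smooth_arc gamma (0 :: s)`_i s`_i]].

(* Independent of the chart by [metric_change]; meaningless at the finitely many
   times where a piecewise smooth path is not differentiable. *)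
Definition speed (gamma : R -> M) (t : R) : R :=
  let c := chart_at (gamma t) in
  let v := derive1 (c \o gamma) t in
  Num.sqrt ((v *m metric g c (gamma t) *m v^T) 0 0).

Definition path_length (gamma : R -> M) : \bar R :=
  (\int[lebesgue_measure]_(t in `[0%R, 1%R]) (speed gamma t)%:E)%E.

(* Real valued when [M] is connected. *)
Definition riemannian_dist (x y : M) : \bar R :=
  ereal_inf [set path_length gamma | gamma in piecewise_smooth_path x y].

Definition borel_space := g_sigma_algebraType (@open M).

(* In each chart [V] has density [sqrt (det metric)] with respect to the Lebesgue
   measure; this determines [V], as countably many chart domains cover [M]. *)
Definition is_riemannian_volume (V : {measure set borel_space -> \bar R}) :
    Prop :=
  forall c (A : set borel_space), atlas X c -> measurable A ->
    A `<=` chart_dom c ->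
    V A = (\int[@lebesgue_rV R n]_(x in (c @` A : set (borel_rV R n)))
             (Num.sqrt (\det (metric g c (chart_inv c x))))%:E)%E.

Definition weighted_measure (V : {measure set borel_space -> \bar R})
    (mu : M -> R) (A : set M) : \bar R :=
  (\int[V]_(x in (A : set borel_space)) (mu x)%:E)%E.

(* Continuous real functions on the boundary with the topology of uniform
   convergence, that is, of the sup norm. *)
Definition boundary_functions : topologicalType :=
  initial_topology
    (id : continuousType boundary R -> {uniform boundary -> R}).

Definition eval_boundary (tau : boundary_functions) : boundary -> R :=
  (tau : continuousType boundary R).

Definition influence_closed (tau : boundary_functions) : set M :=
  [set x | exists y : boundary,
     (riemannian_dist x (val y) <= (eval_boundary tau y)%:E)%E].

Definition influence_open (tau : boundary_functions) : set M :=
  [set x | exists y : boundary,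
     (riemannian_dist x (val y) < (eval_boundary tau y)%:E)%E].

Definition Q_set (V : {measure set borel_space -> \bar R}) (mu : M -> R) :
    set boundary_functions :=
  [set tau | (weighted_measure V mu (influence_closed tau) <
              weighted_measure V mu setT)%E].

Definition Q_tilde : set boundary_functions :=
  [set tau | ~` influence_open tau !=set0].

End manifold.

(* Main.v *)
Require Import Defs.
From HB Require Import structures.
From mathcomp Require Import all_boot all_order all_algebra.
From mathcomp Require Import ring lra.
From mathcomp Require Import all_classical all_reals all_analysis measurable_realfun.
Set Implicit Arguments. Unset Strict Implicit. Unset Printing Implicit Defensive.
Import Order.TTheory GRing.Theory Num.Theory numFieldNormedType.Exports.
Local Open Scope classical_set_scope.
Local Open Scope ring_scope.

(* A tau in Q has its closed domain of influence different from M, so it lies in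
   Q~; and Q~ is closed, because if every x has a boundary point y with
   d(x, y) < tau(y), then by compactness there is such a y with
   d(x, y) < tau(y) - e for a uniform e > 0, a property inherited by the functions
   close to tau. Conversely, if d(x, .) >= tau then the ball of radius e / 4
   around x misses the closed domain of influence of tau - e / 2; this ball is a
   neighbourhood of x, hence has positive measure, and m(M) is finite. The metric
   input is the triangle inequality and the bound of the distance by the Euclidean
   distance in a chart, given by the length of a coordinate segment. *)

(** * Integrals of functions that need not be measurable *)

(* The integral of a nonnegative function is a supremum over the simple functions
   below it, so the inequalities needed for path lengths hold without knowing that
   the speed is measurable. *)
Section lower_integral.
Context d (T : measurableType d) (R : realType).
Variable m : {measure set T -> \bar R}.
Import HBNNSimple.
Local Open Scope ereal_scope.

Lemma lower_integral_mono (D E : set T) (f g : T -> \bar R) :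
  (forall x, D x -> 0 <= f x) -> (forall x, E x -> 0 <= g x) ->
  (forall x, D x -> E x /\ f x <= g x) ->
  \int[m]_(x in D) f x <= \int[m]_(x in E) g x.
Proof.
move=> f0 g0 fg; rewrite !ge0_integralE//.
apply: le_ereal_sup => _ [h /= hf <-]; exists h => //= x.
apply: le_trans (hf x) _; rewrite !patchE.
case: ifPn => xD; last by case: ifPn => // /set_mem/g0.
by have [Ex fgx] := fg _ (set_mem xD); rewrite mem_set.
Qed.

(** This reduces a bound of the integral to simple functions, which are measurable, so that
    additivity and change of variables apply to them. *)
Lemma lower_integral_ub (D : set T) (f : T -> \bar R) c :
  (forall x, D x -> 0 <= f x) ->
  (forall h : {nnsfun T >-> R}, (forall x, ~ D x -> h x = 0%R) ->
     (forall x, D x -> (h x)%:E <= f x) -> \int[m]_x (h x)%:E <= c) ->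
  \int[m]_(x in D) f x <= c.
Proof.
move=> f0 fc; rewrite ge0_integralE//.
apply: ge_ereal_sup => _ [h /= hf <-]; rewrite -integralT_nnsfun; apply: fc => x Dx.
  by apply/eqP; rewrite eq_le fun_ge0 andbT; move: (hf x); rewrite patchE memNset.
by move: (hf x); rewrite patchE mem_set.
Qed.

(** The integral of a simple function below [f] splits over [A] and the rest of [B], and each part
    is at most the corresponding integral of [f]. *)
Lemma lower_integral_setU (A B : set T) (f : T -> \bar R) :
  measurable A -> measurable B -> (forall x, 0 <= f x) ->
  \int[m]_(x in A `|` B) f x <= \int[m]_(x in A) f x + \int[m]_(x in B) f x.
Proof.
move=> mA mB f0; apply: lower_integral_ub => // h h0 hf.
have mBA : measurable (B `\` A) by exact: measurableD.
have mh (D : set T) : measurable_fun D (fun x => (h x)%:E).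
  by apply/measurable_EFinP; exact: measurable_funTS.
have UD : A `|` B = A `|` (B `\` A).
  apply/seteqP; split=> x [?|]; [by left| |by left|by case; right].
  by have [?|?] := pselect (A x); [left|right].
have -> : \int[m]_x (h x)%:E = \int[m]_(x in A `|` (B `\` A)) (h x)%:E.
  rewrite [RHS]integral_mkcond; apply: eq_integral => x _.
  rewrite patchE -UD; case: ifPn => // /negP; rewrite in_setE => nx.
  by rewrite h0.
rewrite ge0_integral_setU//; last 2 first.
  by move=> x _; rewrite lee_fin fun_ge0.
  by apply/disj_setPS => x [Ax []].
apply: leeD; apply: lower_integral_mono => //.
- by move=> x _; rewrite lee_fin fun_ge0.
- by move=> x Ax; split => //; apply: hf; left.
- by move=> x _; rewrite lee_fin fun_ge0.
- by move=> x [Bx _]; split => //; apply: hf; right.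
Qed.

End lower_integral.

(** * Affine change of variables *)

Section affine_substitution.
Context (R : realType).
Variables (a b : R).
Hypothesis a0 : 0 < a.
Let phi (t : measurableTypeR R) : measurableTypeR R := a * t + b.
Import HBNNSimple.

Let mphi : measurable_fun setT phi.
Proof. by apply: measurable_funD => //; apply: measurable_funM. Qed.

(** The right-hand side is a pushforward of Lebesgue measure scaled by [a]; by uniqueness of
    Lebesgue measure it suffices to compare half-open intervals. *)
Lemma lebesgue_measure_affine (A : set R) : measurable A ->
  lebesgue_measure A = (a%:E * lebesgue_measure (phi @^-1` A))%E.
Proof.
move=> mA.
have -> : (a%:E * lebesgue_measure (phi @^-1` A))%E =
    mscale (NngNum (ltW a0)) (pushforward lebesgue_measure phi) A by [].
apply: lebesgue_measure_unique => //= _ [[p q]] _ <-.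
rewrite /mscale/= /pushforward.
have -> : phi @^-1` [set` `]p, q] ] = [set` `](a^-1 * (p - b)), (a^-1 * (q - b))] ].
  apply/seteqP; split => x /=; rewrite !in_itv/= /phi;
  by rewrite ler_pdivlMl // ltr_pdivrMl // lerBrDr ltrBlDr.
rewrite !lebesgue_measure_itv/= !lte_fin ltr_pM2l ?invr_gt0// ltrD2r.
case: ifPn => _; last by rewrite mule0.
by rewrite -!EFinB -EFinM; congr EFin; field; rewrite gt_eqF.
Qed.

Local Open Scope ereal_scope.

Lemma ge0_integral_affine (h : measurableTypeR R -> \bar R) : measurable_fun setT h ->
  (forall x, 0 <= h x) ->
  \int[lebesgue_measure]_x h x = \int[lebesgue_measure]_x (a%:E * h (a * x + b)%R).
Proof.
move=> mh h0.
rewrite ge0_integralZl//; last 2 first.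
  exact: measurableT_comp mphi.
  by rewrite lee_fin ltW.
rewrite -[X in _ = _ * X]/(\int[lebesgue_measure]_(x in phi @^-1` setT) (h \o phi) x).
rewrite -ge0_integral_pushforward//.
rewrite -(ge0_integral_mscale (pushforward lebesgue_measure phi) measurableT (NngNum (ltW a0)))//.
apply: eq_measure_integral => A mA _.
by rewrite /mscale/=; exact: lebesgue_measure_affine.
Qed.

End affine_substitution.

Section lower_integral_affine.
Import HBNNSimple.

(** The inverse substitution is made on a simple function [h] below [f]: the function
    [a^-1 * h (a^-1 * (x - b))] is then below [g] on [D] and vanishes elsewhere. *)
Lemma lower_integral_affine (R : realType) (a b : R) (D : set R) (f g : R -> \bar R) :
  0 < a -> (forall x, (0 <= f x)%E) -> (forall x, (0 <= g x)%E) ->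
  (forall x, D (a * x + b) -> (f x <= a%:E * g (a * x + b)%R)%E) ->
  (\int[lebesgue_measure]_(x in [set x | D (a * x + b)%R]) f x <=
   \int[lebesgue_measure]_(x in D) g x)%E.
Proof.
move=> a0 f0 g0 fg; apply: lower_integral_ub => // h h0 hf.
have ai0 : 0 < a^-1 by rewrite invr_gt0.
rewrite (ge0_integral_affine (- (a^-1 * b)) ai0); last 2 first.
  by apply/measurable_EFinP; exact: (@measurable_funPT _ _ _ _ h).
  by move=> x; rewrite lee_fin fun_ge0.
have aK x : a * (a^-1 * x - a^-1 * b) + b = x by field; rewrite gt_eqF.
rewrite [leRHS]integral_mkcond; apply: lower_integral_mono => //.
- by move=> x _; rewrite -EFinM lee_fin mulr_ge0// ?fun_ge0// ltW.
- by move=> x _; apply: erestrict_ge0.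
- move=> x _; split => //; rewrite patchE; case: ifPn => [/set_mem Dx|/negP nDx].
    have := fg (a^-1 * x - a^-1 * b); rewrite aK => /(_ Dx) fgx.
    rewrite muleC lee_pdivrMr// muleC; apply: le_trans fgx.
    by apply: hf; rewrite /= aK.
  by rewrite h0 ?mule0//= aK => Dx; apply: nDx; rewrite inE.
Qed.

End lower_integral_affine.

(** * Derivatives and affine maps *)

Section affine_derivative.
Variables (R : realType).
Local Notation dnbhs0 := (0^' : set_system R).

(** A nonzero scaling tends to 0 without reaching it; this is used for both [k] and [k^-1], one for
    each inclusion of filters. *)
Lemma dnbhs0_scale (k : R) : k != 0 -> (fun h : R => k * h) @ 0^' = 0^'.
Proof.
have sub (c : R) : c != 0 -> (fun h : R => c * h) @ 0^' --> 0^'.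
  move=> c0 A; rewrite /dnbhs !nbhs_simpl /= /within => A0.
  have : (fun h : R => c * h) @ 0 --> 0.
    by rewrite -[X in _ --> X](mulr0 c); apply: cvgM; [exact: cvg_cst|exact: cvg_id].
  move=> /(_ _ A0); rewrite nbhs_simpl /=; apply: filterS => x /= Ax x0.
  by apply: Ax; rewrite mulf_neq0.
move=> k0; apply/seteqP; split => A.
  move=> kA; have := sub k^-1 (invr_neq0 k0) _ kA.
  by rewrite nbhs_simpl /=; apply: filterS => x /=; rewrite mulVKf.
exact: sub.
Qed.

(* When the limit does not exist, both derivatives are the default value [point]. *)
Lemma derive_scale (W : normedModType R) (f : R -> W) (k x : R) : 0 < k ->
  'D_k f x = k *: 'D_1 f x \/ 'D_k f x = 'D_1 f x.
Proof.
move=> k0; rewrite /derive.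
set F1 := (X in lim (X @ _) = k *: _ \/ _).
set F2 := (X in _ = k *: lim (X @ _) \/ _).
have k0' := lt0r_neq0 k0.
have F12 : F1 = (fun h => k *: F2 h) \o (fun h => k * h).
  apply/funext => h; rewrite /F1 /F2/= scalerA invfM mulrA mulfV// mul1r.
  by rewrite !scaler1 [h *: k]mulrC.
have -> : F1 @ 0^' = (fun h => k *: F2 h) @ 0^'.
  by rewrite F12 fmap_comp dnbhs0_scale.
have [cF|dF] := pselect (cvg (F2 @ 0^')).
  left; apply: cvg_lim => //; exact: cvgZr.
right; rewrite (dvgP dF); apply: dvgP; apply: contra_not dF => ckF.
have -> : F2 = (fun h => k^-1 *: (k *: F2 h)).
  by apply/funext => h; rewrite scalerA mulVf// scale1r.
exact: is_cvgZr.
Qed.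

(** The two difference quotients coincide as functions of the increment, so the equality also holds
    where the limits do not exist. *)
Lemma derive_comp_affine (E F W : normedModType R) (L : {linear E -> F}) (p : F)
   (f : F -> W) (v : E) :
  'D_v (fun x => f (L x + p)) = (fun x => 'D_(L v) f (L x + p)).
Proof.
apply/funext => x; rewrite /derive.
apply: (congr1 (fun q : R -> W => lim (q @ 0^'))).
by apply/funext => h; rewrite /= (linearP L) addrA.
Qed.

(** Induction on [k] for all [f]: by [derive_comp_affine], a directional derivative of the composite
    is again a composite with the same affine map. *)
Lemma class_C_comp_affine (E F W : normedModType R) (L : {linear E -> F}) (p : F) k
    (U : set F) (f : F -> W) : continuous L ->
  class_C k U f -> class_C k ((fun x => L x + p) @^-1` U) (fun x => f (L x + p)).
Proof.
move=> cL; have cA : continuous (fun x => L x + p).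
  by move=> x; apply: cvgD; [exact: cL|exact: cvg_cst].
elim: k f => [|k IH] f /=.
  move=> cf x Ux; apply: (@continuous_comp _ _ _ (fun x => L x + p) f x).
    exact: cA.
  exact: cf.
move=> [df Cf]; split => [x Ux|v].
  apply: (@differentiable_comp _ _ _ _ (fun x => L x + p) f); last exact: df.
  apply: (@differentiableD _ _ _ L (cst p)); last exact: differentiable_cst.
  exact: linear_differentiable.
by rewrite derive_comp_affine; exact: (IH _ (Cf (L v))).
Qed.

End affine_derivative.

Section smooth_affine.
Variable R : realType.

(** The local extensions are composed with the affine map. This serves for reparametrized arcs and
    for segments read in a chart. *)
Lemma smooth_on_comp_affine (E F W : normedModType R) (L : {linear E -> F}) (p : F)
    (D : set F) (f : F -> W) (D' : set E) (f' : E -> W) :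
  continuous L -> smooth_on D f ->
  (forall y, D' y -> D (L y + p) /\ f' y = f (L y + p)) -> smooth_on D' f'.
Proof.
move=> cL sf ff' x D'x; have [Dx _] := ff' _ D'x.
have [U [T [oU Ux CT fT]]] := sf _ Dx.
exists ((fun y => L y + p) @^-1` U), (fun y => T (L y + p)); split => //.
- apply: open_comp oU => y _; apply: (@cvgD _ _ _ _ _ L (cst p)); first exact: cL.
  exact: cvg_cst.
- by move=> k; exact: class_C_comp_affine.
- by move=> y /ff'[Dy ->] Uy; exact: fT.
Qed.
End smooth_affine.

(** * Concatenation of paths *)

Section path_concatenation.
Variables (R : realType) (n : nat) (M : ptopologicalType) (X : smooth_manifold R n M).
Variable g : riemannian_metric X.
Implicit Types (gamma : R -> M).

Lemma smooth_arc_affine gamma gamma' (k p a b a' b' : R) :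
  smooth_arc X gamma a b ->
  (forall t, a' <= t <= b' -> a <= k * t + p <= b /\ gamma' t = gamma (k * t + p)) ->
  smooth_arc X gamma' a' b'.
Proof.
move=> sa gg' c ac.
apply: (@smooth_on_comp_affine R R^o R^o _ (GRing.scale (k : R^o)) p _ _ _ _ _ (sa c ac)).
  exact: scaler_continuous.
move=> t [/= tab dt]; have [ab gt] := gg' t tab.
by rewrite gt in dt *; split.
Qed.

Lemma speed_ge0 gamma t : 0 <= speed g gamma t.
Proof. exact: sqrtr_ge0. Qed.

(** Where the derivative exists, equality holds. Elsewhere [derive_scale] may give the same default
    value on both sides, and [1 <= k] absorbs the missing factor. *)
Lemma speed_affine gamma gamma' (k p t : R) : 1 <= k ->
  (\forall s \near t, gamma' s = gamma (k * s + p)) ->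
  speed g gamma' t <= k * speed g gamma (k * t + p).
Proof.
move=> k1 gg'; have k0 : 0 < k by exact: lt_le_trans k1.
rewrite /speed (nbhs_singleton gg').
set c := chart_at X _; set G := metric g c _.
have -> : derive1 (c \o gamma') t = 'D_k (c \o gamma) (k * t + p).
  rewrite derive1E (@near_eq_derive _ R^o _ _ (fun s => (c \o gamma) (k * s + p))); last first.
    by apply: filterS gg' => s /= ->.
  have := @derive_comp_affine R R^o R^o _ (GRing.scale (k : R^o)) p (c \o gamma) 1.
  by move=> /(congr1 (@^~ t)) /=; rewrite [k *: 1](mulr1).
rewrite derive1E; have [->|->] := derive_scale (c \o gamma) (k * t + p) k0; last first.
  by rewrite ler_peMl// sqrtr_ge0.
set v := derive _ _ _.
have -> : ((k *: v) *m G *m (k *: v)^T) 0 0 = k ^+ 2 * (v *m G *m v^T) 0 0.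
  by rewrite linearZ /= -scalemxAl -scalemxAl -scalemxAr scalerA mxE expr2.
by rewrite sqrtrM ?sqr_ge0// sqrtr_sqr gtr0_norm.
Qed.

(** The endpoints form a null set. They are discarded because the two-sided derivative there depends
    on [gamma] outside of the unit interval. *)
Lemma path_length_interior gamma :
  (path_length g gamma <=
   \int[lebesgue_measure]_(t in [set t | (0 < t < 1)%R]) (speed g gamma t)%:E)%E.
Proof.
rewrite /path_length.
have -> : `[0%R, 1%R]%classic = [set 0] `|` [set 1] `|` [set t : R | 0 < t < 1].
  apply/seteqP; split => t /=; rewrite in_itv/=.
    rewrite !le_eqVlt => /andP[/orP[/eqP<-|t0] /orP[/eqP|t1]]; try by left; left.
      by move=> ->; left; right.
    by right; rewrite t0 t1.
  by move=> [[->|->]|/andP[t0 t1]]; rewrite ?lexx ?ler01// !ltW.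
have mo : measurable [set t : R | 0 < t < 1].
  by rewrite [X in measurable X](_ : _ = `]0, 1[%classic)//;
    apply/seteqP; split => t; rewrite /= in_itv.
apply: le_trans (lower_integral_setU _ _ _ _) _ => //.
- by apply: measurableU; exact: measurable_set1.
- by move=> t; rewrite lee_fin speed_ge0.
rewrite -[leRHS]add0e leeD2r//.
apply: le_trans (lower_integral_setU _ _ _ _) _ => //.
  by move=> t; rewrite lee_fin speed_ge0.
by rewrite !integral_set1 adde0.
Qed.

(** The term [+ 0] puts both branches in the form [2 * t + p] of the affine lemmas. *)
Definition path_concat gamma1 gamma2 (t : R) : M :=
  if t <= 2^-1 then gamma1 (2 * t + 0) else gamma2 (2 * t + -1).

Lemma path_concatl gamma1 gamma2 t : t <= 2^-1 ->
  path_concat gamma1 gamma2 t = gamma1 (2 * t + 0).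
Proof. by rewrite /path_concat => ->. Qed.

Lemma path_concatr gamma1 gamma2 t : gamma1 1 = gamma2 0 -> 2^-1 <= t ->
  path_concat gamma1 gamma2 t = gamma2 (2 * t + -1).
Proof.
move=> g12 t2; rewrite /path_concat; case: ifPn => // t2'.
have -> : t = 2^-1 by apply/eqP; rewrite eq_le t2'.
by rewrite mulfV// subrr addr0.
Qed.

(** The midpoint is a null set; on each open half, the speed is at most twice that of the
    corresponding path, and the substitution [2 * t + p] absorbs the factor 2. *)
Lemma path_length_concat gamma1 gamma2 :
  (path_length g (path_concat gamma1 gamma2) <=
   path_length g gamma1 + path_length g gamma2)%E.
Proof.
set gamma := path_concat _ _.
pose D : set R := [set t | 0 < t < 1].
have sub h : (\int[lebesgue_measure]_(t in D) (speed g h t)%:E <= path_length g h)%E.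
  apply: lower_integral_mono => [t _|t _|t /andP[t0 t1]]; rewrite ?lee_fin ?speed_ge0//.
  by split => //; rewrite /= in_itv/= !ltW.
(* [A 0] is the open interval from 0 to 1/2, and [A (-1)] the one from 1/2 to 1. *)
pose A p : set R := [set t | D (2 * t + p)].
have mA p : measurable (A p).
  rewrite [X in measurable X](_ : _ = `](- p / 2), ((1 - p) / 2)[%classic)//.
  apply/seteqP; split => t; rewrite /A /D /= in_itv/=.
    by move=> /andP[? ?]; apply/andP; split; lra.
  by move=> /andP[? ?]; apply/andP; split; lra.
apply: le_trans (path_length_interior _) _.
apply: (@le_trans _ _ (\int[lebesgue_measure]_(t in ([set 2^-1] `|` (A 0 `|` A (-1)))%R) (speed g gamma t)%:E)%E).
  apply: lower_integral_mono => [t _|t _|t /andP[t0 t1]]; rewrite ?lee_fin ?speed_ge0//.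
  split => //; have [t2|t2|->] := ltgtP t 2^-1; last by left.
    by right; left; rewrite /A /D/=; apply/andP; split; lra.
  by right; right; rewrite /A /D/=; apply/andP; split; lra.
have s0 t : (0 <= (speed g gamma t)%:E)%E by rewrite lee_fin speed_ge0.
have s10 t : (0 <= (speed g gamma1 t)%:E)%E by rewrite lee_fin speed_ge0.
have s20 t : (0 <= (speed g gamma2 t)%:E)%E by rewrite lee_fin speed_ge0.
apply: le_trans (lower_integral_setU lebesgue_measure
  (measurable_set1 _) (measurableU _ _ (mA 0) (mA (-1))) s0) _.
rewrite integral_set1 add0e.
apply: le_trans (lower_integral_setU lebesgue_measure (mA 0) (mA (-1)) s0) _.
apply: leeD.
  apply: le_trans (sub _); apply: (@lower_integral_affine R 2 0 D) s0 s10 _.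
    exact: ltr0n.
  move=> t /andP[_ t1]; rewrite -EFinM lee_fin; apply: speed_affine; first by rewrite ler1n.
  have : t < 2^-1 by lra.
  move=> /lt_nbhsl; apply: filterS => s s2; apply: path_concatl; exact: ltW.
apply: le_trans (sub _); apply: (@lower_integral_affine R 2 (-1) D) s0 s20 _.
  exact: ltr0n.
move=> t /andP[t0 t1]; rewrite -EFinM lee_fin; apply: speed_affine; first by rewrite ler1n.
have : 2^-1 < t by lra.
by move=> /lt_nbhsr; apply: filterS => s s2; rewrite /gamma /path_concat leNgt s2.
Qed.

End path_concatenation.

(** * The triangle inequality *)

Section riemannian_dist_triangle.
Variables (R : realType) (n : nat) (M : ptopologicalType) (X : smooth_manifold R n M).
Variable g : riemannian_metric X.

Lemma partition_bounds (s : seq R) i : path <%R 0 s -> last 0 s = 1 ->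
  (i < size s)%N -> 0 <= (0 :: s)`_i /\ s`_i <= 1.
Proof.
move=> ps ls si.
have ss : sorted <=%R (0 :: s).
  by apply: sub_path ps => x y; exact: ltW.
have H := sorted_leq_nth le_trans lexx 0 ss; split.
  by apply: (H 0%N i) => //; rewrite inE /= ltnS ltnW.
rewrite -[s`_i]/((0 :: s)`_i.+1) -ls (last_nth 0).
by apply: H; rewrite ?inE /= ?ltnS.
Qed.

Lemma path_concat_piecewise_smooth x y z gamma1 gamma2 :
  piecewise_smooth_path X x y gamma1 -> piecewise_smooth_path X y z gamma2 ->
  piecewise_smooth_path X x z (path_concat gamma1 gamma2).
Proof.
move=> [c1 g10 g11 [s1 [p1 l1 h1]]] [c2 g20 g21 [s2 [p2 l2 h2]]].
have g12 : gamma1 1 = gamma2 0 by rewrite g11 g20.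
split.
- have -> : `[0, 1]%classic = `[0, 2^-1]%classic `|` `[2^-1, (1 : R)]%classic.
    apply/seteqP; split => t /=; rewrite !in_itv/=.
      by move=> /andP[t0 t1]; rewrite t0 t1 andbT; apply/orP; exact: le_total.
    by case=> /andP[? ?]; apply/andP; split; lra.
  have caff p : continuous (fun t : R => 2 * t + p).
    by move=> t; apply: cvgD; [apply: cvgM; [exact: cvg_cst|exact: cvg_id]|exact: cvg_cst].
  (* Common to the two closed halves, with [p = 0] on the first and [p = -1] on the second. *)
  have pull (p : R) (gamma : R -> M) (I : set R) : {within `[0, 1], continuous gamma} ->
      (forall t, I t -> 0 <= 2 * t + p <= 1 /\
         path_concat gamma1 gamma2 t = gamma (2 * t + p)) ->
      {within I, continuous (path_concat gamma1 gamma2)}.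
    move=> /subspace_continuousP cg Ig; apply/subspace_continuousP => t It.
    rewrite -[X in _ --> X]/(path_concat gamma1 gamma2 t).
    have [t01 ->] := Ig t It.
    have := cg (2 * t + p); rewrite /= in_itv /= => /(_ t01) cgt A /cgt.
    rewrite /= !nbhs_simpl /= /within /=.
    move=> /(caff p t); rewrite nbhs_simpl/=; apply: filterS => u /= hu Iu.
    rewrite -[X in A X]/(path_concat gamma1 gamma2 u).
    by have [u01 ->] := Ig u Iu; apply: hu; rewrite in_itv.
  apply: withinU_continuous; [exact: itv_closed|exact: itv_closed| |].
    apply: (pull 0 gamma1) => // t; rewrite /= in_itv /= => /andP[t0 t2].
    by rewrite path_concatl//; split => //; apply/andP; split; lra.
  apply: (pull (-1) gamma2) => // t; rewrite /= in_itv /= => /andP[t0 t2].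
  by rewrite path_concatr//; split => //; apply/andP; split; lra.
- by rewrite path_concatl ?invr_ge0// mulr0 addr0.
- rewrite path_concatr//; last by rewrite invf_le1// ler1n.
  by rewrite mulr1 (_ : 2 + -1 = 1)//; lra.
(* These are the inverses of [2 * t] and [2 * t - 1]; the subdivision wanted is the image of [s1]
   under [e1] followed by that of [s2] under [e2]. *)
pose e1 (t : R) := 2^-1 * t; pose e2 (t : R) := 2^-1 * (1 + t).
have e1l : last 0 (map e1 s1) = 2^-1.
  by rewrite -[0](_ : e1 0 = 0) ?last_map ?l1 /e1 ?mulr0 ?mulr1.
have e20 : e2 0 = 2^-1 by rewrite /e2 addr0 mulr1.
have sz1 : size (map e1 s1) = size s1 by rewrite size_map.
have nth1 i : (i <= size s1)%N -> (0 :: map e1 s1 ++ map e2 s2)`_i = e1 (0 :: s1)`_i.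
  move=> i1; rewrite -cat_cons nth_cat /= sz1 ltnS i1.
  rewrite -[0 :: map e1 s1](_ : map e1 (0 :: s1) = _); last by rewrite /= /e1 mulr0.
  by rewrite (nth_map 0).
(* For [i = 0] this is the junction 1/2, at once the last point of the first subdivision and the
   image of the implicit initial 0 of the second. *)
have nth2 i : (i <= size s2)%N ->
    (0 :: map e1 s1 ++ map e2 s2)`_(size s1 + i) = e2 (0 :: s2)`_i.
  move=> i2; case: i i2 => [|i] i2.
    rewrite addn0 nth1// -last_nth l1 /= e20 /e1 mulr1//.
  rewrite addnS /= nth_cat sz1 ltnNge leq_addr /= addKn (nth_map 0)//.
exists (map e1 s1 ++ map e2 s2); split.
- rewrite cat_path; apply/andP; split.
    rewrite -[0](_ : e1 0 = 0) ?path_map; last by rewrite /e1 mulr0.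
    by apply: sub_path p1 => a b /= ab; rewrite /e1 ltr_pM2l// invr_gt0.
  rewrite e1l -e20 path_map.
  by apply: sub_path p2 => a b /= ab; rewrite /e2 ltr_pM2l ?invr_gt0// ltrD2l.
- by rewrite last_cat e1l -e20 last_map l2 /e2 (_ : 1 + 1 = 2)// mulVf.
- move=> i; rewrite size_cat !size_map => si.
  have [i1|i1] := ltnP i (size s1).
    have [lo hi] := partition_bounds p1 l1 i1.
    rewrite nth1; last exact: ltnW.
    have -> : (map e1 s1 ++ map e2 s2)`_i = e1 s1`_i by exact: (nth1 i.+1).
    apply: (smooth_arc_affine (k := 2) (p := 0)) (h1 i i1) _ => t; rewrite /e1 => /andP[t0 t1].
    by rewrite path_concatl; [split => //; apply/andP; split|]; lra.
  have i2 : (i - size s1 < size s2)%N by rewrite ltn_subLR.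
  have [lo hi] := partition_bounds p2 l2 i2.
  rewrite -(subnKC i1) nth2; last exact: ltnW.
  have -> : (map e1 s1 ++ map e2 s2)`_(size s1 + (i - size s1)) = e2 s2`_(i - size s1).
    by have := nth2 (i - size s1).+1 i2; rewrite addnS.
  apply: (smooth_arc_affine (k := 2) (p := -1)) (h2 _ i2) _ => t; rewrite /e2 => /andP[t0 t1].
  by rewrite path_concatr//; [split => //; apply/andP; split|]; lra.
Qed.

(** Strict real bounds provide paths of length less than [a] and [b], which are concatenated; this
    form of the triangle inequality avoids sums of infinite distances. *)
Lemma riemannian_dist_lt_add x y z (a b : R) :
  (riemannian_dist g x y < a%:E -> riemannian_dist g y z < b%:E ->
   riemannian_dist g x z < (a + b)%:E)%E.
Proof.
move=> /ereal_inf_lt[_ [g1 p1 <-] l1] /ereal_inf_lt[_ [g2 p2 <-] l2].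
apply: (@le_lt_trans _ _ (path_length g (path_concat g1 g2))).
  apply: ereal_inf_lbound; exists (path_concat g1 g2) => //.
  exact: path_concat_piecewise_smooth p1 p2.
apply: le_lt_trans (path_length_concat g g1 g2) _.
by rewrite EFinD; exact: lteD.
Qed.

Lemma riemannian_dist_ge0 x y : (0 <= riemannian_dist g x y)%E.
Proof.
apply: le_ereal_inf_tmp => _ [gamma _ <-]; apply: integral_ge0 => t _.
by rewrite lee_fin speed_ge0.
Qed.

End riemannian_dist_triangle.

(** * Distances in a chart *)

(** A line through the origin is encoded as a linear map on [R^o], as the lemmas on affine
    composition require. *)
Section scalel.
Variables (R : realType) (V : normedModType R) (w : V).
Definition scalel (t : R^o) : V := t *: w.
Let scalel_is_linear : linear scalel.
Proof. by move=> a s t; rewrite /scalel scalerDl scalerA. Qed.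
HB.instance Definition _ := GRing.isLinear.Build R R^o V *:%R scalel scalel_is_linear.
End scalel.

Section convexity.
Variables (R : realType) (n : nat).

Lemma half_space_segment (p q : 'rV[R]_n) t : 0 <= t <= 1 ->
  half_space p -> half_space q -> half_space (t *: (q - p) + p).
Proof.
move=> /andP[t0 t1] hp hq i i0; rewrite !mxE.
have -> : t * (q 0 i - p 0 i) + p 0 i = (1 - t) * p 0 i + t * q 0 i by ring.
by rewrite addr_ge0// mulr_ge0// ?subr_ge0// ?hp ?hq.
Qed.

Lemma ball_segment (V : normedModType R) (a p q : V) r t : 0 <= t <= 1 ->
  ball a r p -> ball a r q -> ball a r (t *: (q - p) + p).
Proof.
move=> /andP[t0 t1]; rewrite -ball_normE /= => ap aq.
have -> : a - (t *: (q - p) + p) = (1 - t) *: (a - p) + t *: (a - q).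
  rewrite scalerBl scale1r addrAC -[RHS]addrA -scalerBr.
  rewrite opprB [a - q + _]addrC subrKA opprD addrA [RHS]addrAC.
  by rewrite addrAC -scalerN opprB addrAC.
apply: le_lt_trans (ler_normD _ _) _; rewrite !normrZ ger0_norm ?subr_ge0// ger0_norm//.
have [->|t0'] := eqVneq t 0; first by rewrite subr0 mul1r mul0r addr0.
have {t0'} {}t0 : 0 < t by rewrite lt_neqAle eq_sym t0'.
have -> : r = (1 - t) * r + t * r by ring.
by rewrite ler_ltD// ?ltr_pM2l// ler_wpM2l ?subr_ge0// ltW.
Qed.

(** The norms are sup norms, so each of the [n ^ 2] terms of the form is at most [B] times the
    square of the norm of [w]. *)
Lemma quadratic_form_le (w : 'rV[R]_n) (G : 'M[R]_n) (B : R) : `|G| <= B ->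
  (w *m G *m w^T) 0 0 <= n%:R ^+ 2 * B * `|w| ^+ 2.
Proof.
move=> GB; rewrite mxE.
have entry m (A : 'M[R]_(m, n)) i j : `|A i j| <= `|A|.
  rewrite /Num.norm/= mx_normrE.
  exact: (le_bigmax _ (fun ij : 'I_m * 'I_n => `|A ij.1 ij.2|) (i, j)).
have B0 : 0 <= B by exact: le_trans GB.
have -> : n%:R ^+ 2 * B * `|w| ^+ 2 = \sum_(j < n) \sum_(i < n) `|w| * B * `|w|.
  by rewrite !sumr_const !card_ord -mulrnA -[RHS]mulr_natl natrM; ring.
apply: ler_sum => j _; rewrite !mxE mulr_suml; apply: ler_sum => i _.
apply: le_trans (ler_norm _) _; rewrite !normrM.
by do 2![apply: ler_pM => //; rewrite ?mulr_ge0//]; apply: le_trans GB.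
Qed.

End convexity.

Section chart_segment.
Variables (R : realType) (n : nat) (M : ptopologicalType) (X : smooth_manifold R n M).
Variable g : riemannian_metric X.

Lemma chart_inv_dom (c : chart R n M) v : (c @` chart_dom c) v ->
  chart_dom c (chart_inv c v) /\ c (chart_inv c v) = v.
Proof. by case=> p dp <-; rewrite chart_mapK. Qed.

Lemma chart_cvg (c : chart R n M) p : chart_dom c p -> c x @[x --> p] --> c p.
Proof.
move=> dp; have := @chart_map_continuous _ _ _ c.
rewrite continuous_open_subspace; last exact: chart_dom_open.
by move=> /(_ p); apply; rewrite inE.
Qed.

Lemma chart_image_ball (c : chart R n M) p : chart_dom c p ->
  \forall v \near c p, half_space v -> (c @` chart_dom c) v.
Proof.
move=> dp; have [U oU cU] := chart_image_open c.
have Up : U (c p) by have : (c @` chart_dom c) (c p) by [exists p]; rewrite cU => -[].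
by have := open_nbhs_nbhs (conj oU Up); apply: filterS => v Uv hv; rewrite cU.
Qed.

Lemma chart_image_half_space (c : chart R n M) p : chart_dom c p -> half_space (c p).
Proof.
move=> dp; have [U oU cU] := chart_image_open c.
by have : (c @` chart_dom c) (c p) by [exists p]; rewrite cU => -[].
Qed.

Variables (c : chart R n M) (ac : atlas X c) (a : 'rV[R]_n) (r B : R).
Hypothesis aB : forall v, ball a r v -> half_space v ->
  (c @` chart_dom c) v /\ `|metric g c (chart_inv c v)| <= B.
Variables (p q : M) (dp : chart_dom c p) (dq : chart_dom c q).
Hypotheses (ap : ball a r (c p)) (aq : ball a r (c q)).

Let w := c q - c p.
Let seg (t : R) := scalel w t + c p.
Let gamma (t : R) := chart_inv c (seg t).

(** The ball and the half space are convex, so the segment stays in the region where the chart is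
    defined and [B] bounds the metric. *)
Let seg_image t : 0 <= t <= 1 ->
  (c @` chart_dom c) (seg t) /\ `|metric g c (gamma t)| <= B.
Proof.
move=> t01; apply: aB; first exact: ball_segment.
by apply: half_space_segment => //; exact: chart_image_half_space.
Qed.

Let seg_continuous : continuous seg.
Proof. by move=> t; apply: cvgD; [exact: scalel_continuous|exact: cvg_cst]. Qed.

Let gamma_within : {within `[0, 1], continuous gamma}.
Proof.
apply/subspace_continuousP => t; rewrite /= in_itv/= => t01.
have /subspace_continuousP := @chart_inv_continuous _ _ _ c.
move=> /(_ _ (seg_image t01).1) ct A /ct.
rewrite /= !nbhs_simpl /= /within /= => /(seg_continuous (x:=t)).
rewrite nbhs_simpl/=; apply: filterS => u /= hu; rewrite in_itv/= => u01.
exact: hu (seg_image u01).1.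
Qed.

Let gamma_dom t : 0 <= t <= 1 -> chart_dom c (gamma t) /\ c (gamma t) = seg t.
Proof. by move=> /seg_image[/chart_inv_dom]. Qed.

Let gamma_overlap (c' : chart R n M) t : 0 <= t <= 1 -> chart_dom c' (gamma t) ->
  chart_overlap c c' (seg t).
Proof.
by move=> /gamma_dom[dg <-] dg'; exists (gamma t).
Qed.

(** Read in another chart, the curve is a transition map composed with an affine map. *)
Let gamma_smooth : smooth_arc X gamma 0 1.
Proof.
move=> c' ac'.
apply: (@smooth_on_comp_affine R R^o _ _ (scalel w) (c p) _ _ _ _ _ (atlas_compatible ac ac')).
  exact: scalel_continuous.
by move=> t [/= t01 dt]; split => //; exact: gamma_overlap.
Qed.

(** The speed is computed in the chart chosen at [gamma t], which may differ from [c]. The velocity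
    there is [w] times the Jacobian matrix of the transition map, and [metric_change] brings the
    form back to the chart [c], where the velocity is [w]. *)
Let speed_gamma t : 0 < t < 1 -> speed g gamma t <= Num.sqrt (n%:R ^+ 2 * B) * `|w|.
Proof.
move=> t01; have t01' : 0 <= t <= 1 by case/andP: t01 => ? ?; rewrite !ltW.
rewrite /speed; set c' := chart_at X (gamma t).
have ac' : atlas X c' by rewrite /c' /chart_at; case: cid2.
have dc' : chart_dom c' (gamma t) by rewrite /c' /chart_at; case: cid2.
have [dg cg] := gamma_dom t01'.
have [U [T [oU Ut CT fT]]] := atlas_compatible ac ac' (gamma_overlap t01' dc').
have dT : differentiable T (seg t) by have [/(_ _ Ut)] := CT 1%N.
have near01 : \forall u \near t, 0 < u < 1.
  case/andP: t01 => /lt_nbhsr t0 /lt_nbhsl t1.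
  by near=> u; apply/andP; split; near: u.
have gc : gamma u @[u --> t] --> gamma t.
  have /subspace_continuousP := gamma_within.
  move=> /(_ t); rewrite /= in_itv/= => /(_ t01') gt A /gt.
  rewrite /= !nbhs_simpl /= /within /= => gA.
  near=> u; suff : gamma u \in A by rewrite inE.
  have : `[0, 1]%classic u -> A (gamma u) by near: u.
  rewrite inE => /=; rewrite in_itv/=; apply.
  suff : 0 < u < 1 by case/andP => ? ?; rewrite !ltW.
  by near: u.
(* Near the interior time [t] the curve stays in the domain of [c'] and the segment in [U], so
   [c' \o gamma] agrees with [T] along the segment. *)
have -> : derive1 (c' \o gamma) t = w *m 'J T (seg t).
  rewrite derive1E (@near_eq_derive _ R^o _ _ (fun s => T (scalel w s + c p))).
    have := @derive_comp_affine R R^o _ _ (scalel w) (c p) T 1.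
    move=> /(congr1 (@^~ t)) /= ->.
    by rewrite [scalel w 1]scale1r deriveEjacobian.
  have nearU : \forall u \near t, U (seg u).
    by apply: seg_continuous; exact: open_nbhs_nbhs.
  have neard : \forall u \near t, chart_dom c' (gamma u).
    by apply: gc; apply: open_nbhs_nbhs; split => //; exact: chart_dom_open.
  near=> u; rewrite -[RHS]fT; first by [].
    apply: gamma_overlap; last by near: u.
    suff : 0 < u < 1 by case/andP => ? ?; rewrite !ltW.
    by near: u.
  suff : U (seg u) by [].
  by near: u.
set G := metric g c' _; set J := 'J T _.
have -> : w *m J *m G *m (w *m J)^T = w *m metric g c (gamma t) *m w^T.
  rewrite (@metric_change _ _ _ _ g c c' (gamma t) U T)//; last by rewrite cg.
  by rewrite cg trmx_mul !mulmxA.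
rewrite -[`|w|]ger0_norm// -sqrtr_sqr -sqrtrM; last first.
  by rewrite mulr_ge0// ?sqr_ge0//; apply: le_trans (seg_image t01').2.
by apply: ler_wsqrtr; apply: quadratic_form_le; exact: (seg_image t01').2.
Unshelve. all: by end_near.
Qed.

Lemma riemannian_dist_chart_le :
  (riemannian_dist g p q <= (Num.sqrt (n%:R ^+ 2 * B) * `|c q - c p|)%:E)%E.
Proof.
apply: (@le_trans _ _ (path_length g gamma)).
  apply: ereal_inf_lbound; exists gamma => //; split => //.
  - by rewrite /gamma /seg /scalel scale0r add0r chart_mapK.
  - by rewrite /gamma /seg /scalel scale1r subrK chart_mapK.
  exists [:: 1]; split => //=; first by rewrite ltr01.
  by case.
apply: le_trans (path_length_interior _ _) _.
set K : R := Num.sqrt _ * _.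
have K0 : 0 <= K by apply: mulr_ge0; [exact: sqrtr_ge0|exact: normr_ge0].
apply: (@le_trans _ _ (\int[lebesgue_measure]_(t in `[0%R, 1%R]) cst K%:E t)%E).
  apply: lower_integral_mono => [t _|t _|t t01]; rewrite ?lee_fin ?speed_ge0//.
  by split; [case/andP: t01 => ? ?; rewrite /= in_itv/= !ltW|exact: speed_gamma].
by rewrite integral_cst//= lebesgue_measure_itv/= lte_fin ltr01 oppr0 adde0 mule1.
Qed.

End chart_segment.

(** * Nearby points are at small distance *)

Section riemannian_dist_near.
Variables (R : realType) (n : nat) (M : ptopologicalType) (X : smooth_manifold R n M).

Lemma chart_atP p : atlas X (chart_at X p) /\ chart_dom (chart_at X p) p.
Proof. by rewrite /chart_at; case: cid2. Qed.

(* At a boundary point [D] is not a neighbourhood of [x], so [f] itself need not be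
   continuous at [x] in the full space. *)
Lemma smooth_on_local (E F : normedModType R) (D : set E) (f : E -> F) x :
  smooth_on D f -> D x ->
  exists T : E -> F, [/\ {for x, continuous T}, T x = f x &
    \forall y \near x, D y -> f y = T y].
Proof.
move=> sf Dx; have [U [T [oU Ux CT fT]]] := sf x Dx.
exists T; split; [exact: (CT 0%N x Ux)|by rewrite fT|].
by have := open_nbhs_nbhs (conj oU Ux); apply: filterS => y Uy Dy; exact: fT.
Qed.

(** Both orders of the arguments follow from the chart estimate by exchanging the ends of the
    segment, which avoids reversing arbitrary paths. *)
Lemma riemannian_dist_near (g : riemannian_metric X) x (e : R) : 0 < e ->
  \forall y \near x, (riemannian_dist g x y < e%:E /\ riemannian_dist g y x < e%:E)%E.
Proof.
move=> e0; have [] := chart_atP x; set c := chart_at X x => ac dx.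
have cx : (c @` chart_dom c) (c x) by exists x.
have [T [cT _ fT]] := smooth_on_local (metric_smooth g ac) cx.
(* The extension [T] is continuous at [c x], so this bounds it, hence also the metric, near
   [c x]. *)
pose B := `|T (c x)| + 1.
have TB : \forall v \near c x, `|T v| <= B.
  by apply: (@cvgr_norm_le _ _ _ _ _ T (T (c x)) cT B); rewrite /B ltrDl.
have /nbhs_ballP[r /= r0 ballP] : \forall v \near c x,
    half_space v -> (c @` chart_dom c) v /\ `|metric g c (chart_inv c v)| <= B.
  have hI := chart_image_ball dx.
  near=> v => hv.
  have cv : (c @` chart_dom c) v by move: hv; near: v.
  split => //.
  have fTv : (c @` chart_dom c) v -> (metric g c \o chart_inv c) v = T v by near: v.
  by rewrite -[metric g c _]/((metric g c \o chart_inv c) v) fTv//; near: v.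
pose K := Num.sqrt (n%:R ^+ 2 * B).
have K0 : 0 <= K by exact: sqrtr_ge0.
(* Only [0 <= K] is known, so [K + 1] serves as a positive divisor. *)
have nb : \forall y \near x, [/\ chart_dom c y, ball (c x) r (c y) & `|c x - c y| < e / (K + 1)].
  have dc : \forall y \near x, chart_dom c y.
    by apply: open_nbhs_nbhs; split => //; exact: chart_dom_open.
  have cc := chart_cvg dx.
  have b1 : \forall y \near x, ball (c x) r (c y).
    by apply: cc; exact: nbhsx_ballx.
  have b2 : \forall y \near x, `|c x - c y| < e / (K + 1).
    by move/cvgrPdist_lt : cc; apply; rewrite divr_gt0// ltr_pwDr.
  by near=> y; split; near: y.
apply: filterS nb => y [dy by_ dxy].
have small (u v : M) : chart_dom c u -> chart_dom c v -> ball (c x) r (c u) ->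
    ball (c x) r (c v) -> `|c v - c u| < e / (K + 1) -> (riemannian_dist g u v < e%:E)%E.
  move=> du dv bu bv uv; apply: le_lt_trans (riemannian_dist_chart_le ac ballP du dv bu bv) _.
  rewrite lte_fin -/K; apply: (@le_lt_trans _ _ ((K + 1) * `|c v - c u|)).
    by rewrite ler_wpM2r// lerDl.
  by rewrite mulrC -ltr_pdivlMr// ltr_pwDr.
have bx := ballxx (c x) r0.
by split; apply: small => //; rewrite distrC.
Unshelve. all: by end_near.
Qed.

End riemannian_dist_near.

(** * The weighted measure *)

Section posdef.
Variable R : rcfType.

Lemma posdef_det_neq0 n (G : 'M[R]_n) :
  (forall v : 'rV[R]_n, v != 0 -> 0 < (v *m G *m v^T) 0 0) -> \det G != 0.
Proof.
move=> posG; apply/det0P => -[v v0 vG].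
by have := posG v v0; rewrite vG mul0mx mxE ltxx.
Qed.

(* The determinant does not vanish on the segment from the identity to [G]. *)
Lemma posdef_det_gt0 n (G : 'M[R]_n) :
  (forall v : 'rV[R]_n, v != 0 -> 0 < (v *m G *m v^T) 0 0) -> 0 < \det G.
Proof.
move=> posG.
(* Along the segment the determinant is a polynomial in the parameter, so the intermediate value
   theorem for polynomials gives a root if [\det G <= 0]. *)
pose p : {poly R} := \det ('X *: map_mx polyC (G - 1%:M) + map_mx polyC 1%:M).
have pE t : p.[t] = \det (t *: (G - 1%:M) + 1%:M).
  rewrite -horner_evalE -det_map_mx; congr (\det _).
  by apply/matrixP => i j; rewrite !mxE [LHS]horner_evalE !hornerE.
have p0 : p.[0] = 1 by rewrite pE scale0r add0r det1.
have p1 : p.[1] = \det G by rewrite pE scale1r subrK.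
rewrite ltNge; apply/negP => G0.
have [t /andP[t0 t1]] : exists2 t, 0 <= t <= 1 & root (- p) t.
  by apply: poly_ivt; rewrite ?ler01// !hornerN p0 p1 oppr_ge0 oppr_le0 ler01.
rewrite rootN /root pE; apply/negP; apply: posdef_det_neq0 => v v0.
have -> : (v *m (t *: (G - 1%:M) + 1%:M) *m v^T) 0 0 =
    t * (v *m G *m v^T) 0 0 + (1 - t) * (v *m v^T) 0 0.
  rewrite mulmxDr mulmx1 -scalemxAr mulmxBr mulmx1 mulmxDl -scalemxAl mulmxBl.
  by rewrite !mxE; ring.
have vv : 0 < (v *m v^T) 0 0.
  have -> : (v *m v^T) 0 0 = \sum_j v 0 j ^+ 2.
    by rewrite mxE; apply: eq_bigr => j _; rewrite mxE expr2.
  rewrite lt_neqAle sumr_ge0 ?andbT => [|j _]; last exact: sqr_ge0.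
  apply: contra v0; rewrite eq_sym psumr_eq0 => [/allP vj|j _]; last exact: sqr_ge0.
  apply/eqP/rowP => j; rewrite mxE; apply/eqP.
  by have := vj j (mem_index_enum j); rewrite sqrf_eq0.
have [->|t0'] := eqVneq t 0; first by rewrite mul0r add0r subr0 mul1r.
by rewrite ltr_wpDr// ?mulr_ge0 ?subr_ge0 ?(ltW vv)// mulr_gt0 ?posG// lt_neqAle eq_sym t0'.
Qed.

End posdef.

Section det_continuous.
Variables (R : realType).

Lemma continuous_det n (T : topologicalType) (f : T -> 'M[R]_n) x :
  {for x, continuous f} -> {for x, continuous (fun y => \det (f y))}.
Proof.
move=> cf; rewrite /determinant.
apply: cvg_big => [|s _]; first exact: add_continuous.
apply: cvgM; first exact: cvg_cst.
apply: cvg_big => [|i _]; first exact: mul_continuous.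
exact: (continuous_comp cf (@coord_continuous _ _ _ _ _ _)).
Qed.

End det_continuous.

Section lebesgue_ball.
Variables (R : realType) (n : nat).

(** A ball of the sup norm is a cube, whose measure is a product of lengths of intervals. *)
Lemma lebesgue_rV_ball (a : 'rV[R]_n) r : 0 < r ->
  (0 < lebesgue_rV (ball a r) < +oo)%E.
Proof.
move=> r0.
have -> : ball a r = [set v : 'rV[R]_n | forall i, ball (a 0 i) r (v 0 i)].
  apply/seteqP; split => v av; first by move=> i; case: av => _ /(_ 0 i).
  by split => // i j; rewrite (ord1 i); exact: av.
rewrite (lebesgue_rV_box (A := fun i => ball (a 0 i) r)); last first.
  by move=> i; exact: measurable_ball.
apply/andP; split.
  apply: (big_ind (fun x => 0 < x)%E) => [|x y|i _]; [exact: lte01|exact: mule_gt0|].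
  by rewrite lebesgue_measure_ball ?ltW// lte_fin pmulrn_lgt0.
suff : (\prod_(i < n) lebesgue_measure (ball (a 0%R i) r) \is a fin_num)%E.
  by rewrite fin_numElt => /andP[].
apply: (big_ind (fun x : \bar R => x \is a fin_num)) => [//|x y|i _]; first exact: fin_numM.
by rewrite lebesgue_measure_ball ?ltW.
Qed.

Lemma measurable_ball_rV (a : 'rV[R]_n) r : measurable (ball a r : set (borel_rV R n)).
Proof. by apply: sub_sigma_algebra; exact: ball_open. Qed.

End lebesgue_ball.

Section weighted_measure.
Variables (R : realType) (n : nat) (M : ptopologicalType) (X : smooth_manifold R n M).
Variable g : riemannian_metric X.
Variables (V : {measure set (borel_space M) -> \bar R}) (mu : M -> R).
Hypotheses (V_volume : is_riemannian_volume g V) (mu_smooth : smooth_function X mu)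
  (mu_gt0 : forall x, 0 < mu x).

Lemma measurable_open (U : set M) : open U -> measurable (U : set (borel_space M)).
Proof. exact: sub_sigma_algebra. Qed.

Lemma smooth_function_continuous : continuous mu.
Proof.
move=> x; have [ac dx] := chart_atP X x; set c := chart_at X x in ac dx.
have cx : (c @` chart_dom c) (c x) by exists x.
have [T [cT Tx fT]] := smooth_on_local (mu_smooth ac) cx.
rewrite /continuous_at.
have -> : mu x = T (c x) by rewrite Tx /= chart_mapK.
have near_eq : \forall y \near x, T (c y) = mu y.
  have dc : \forall y \near x, chart_dom c y.
    by apply: open_nbhs_nbhs; split => //; exact: chart_dom_open.
  have fTc : \forall y \near x, (c @` chart_dom c) (c y) -> (mu \o chart_inv c) (c y) = T (c y).
    exact: (chart_cvg dx fT).
  near=> y.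
  have dy : chart_dom c y by near: y.
  rewrite -[mu y](_ : (mu \o chart_inv c) (c y) = _); last by rewrite /= chart_mapK.
  apply/esym; have cy : (c @` chart_dom c) (c y) by exists y.
  by move: cy; near: y.
apply: cvg_trans (near_eq_cvg near_eq) _.
exact: (cvg_comp _ _ (chart_cvg dx) cT).
Unshelve. all: by end_near.
Qed.

Lemma measurable_weight : measurable_fun setT (mu : borel_space M -> measurableTypeR R).
Proof.
apply: (measurability _ (RGenOInfty.measurableE R)) => _ [_ [a ->] <-].
rewrite setTI; apply: measurable_open.
apply: open_comp; last exact: interval_open.
by move=> y _; exact: smooth_function_continuous.
Qed.

(** This is applied to the volume density and to the weight, both read in the chart through a
    continuous local extension [T]. *)
Lemma chart_local_bounds (c : chart R n M) x (f : M -> R) (T : 'rV[R]_n -> R) :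
  chart_dom c x -> {for c x, continuous T} -> T (c x) = f x -> 0 < f x ->
  (\forall v \near c x, (c @` chart_dom c) v -> f (chart_inv c v) = T v) ->
  \forall v \near c x, (c @` chart_dom c) v -> f x / 2 <= f (chart_inv c v) <= f x + 1.
Proof.
move=> dx cT Tx fx fT.
have cTf : T v @[v --> c x] --> f x by rewrite -Tx; exact: cT.
have lo : \forall v \near c x, f x / 2 < T v.
  by apply: (cvgr_gt _ cTf); lra.
have hi : \forall v \near c x, T v < f x + 1.
  by apply: (cvgr_lt _ cTf); lra.
near=> v => cv.
have -> : f (chart_inv c v) = T v by move: cv; near: v.
by apply/andP; split; apply: ltW; near: v.
Unshelve. all: by end_near.
Qed.

Let density (c : chart R n M) (p : M) := Num.sqrt (\det (metric g c p)).

Lemma chart_density_bounds (c : chart R n M) x (N : set M) :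
  atlas X c -> chart_dom c x -> nbhs x N ->
  exists r d B : R, [/\ 0 < r, 0 < d, 0 < B & forall v, ball (c x) r v -> half_space v ->
    [/\ (c @` chart_dom c) v, N (chart_inv c v),
        d <= density c (chart_inv c v) <= B & d <= mu (chart_inv c v) <= B]].
Proof.
move=> ac dx Nx; have cx : (c @` chart_dom c) (c x) by exists x.
have rho0 : 0 < density c x.
  by rewrite sqrtr_gt0; apply: posdef_det_gt0 => v; exact: metric_posdef.
have [T [cT Tx fT]] := smooth_on_local (metric_smooth g ac) cx.
have b1 : \forall v \near c x, (c @` chart_dom c) v ->
    density c x / 2 <= density c (chart_inv c v) <= density c x + 1.
  apply: (@chart_local_bounds c x (density c) (fun v => Num.sqrt (\det (T v)))) => //.
  - apply: continuous_comp; first exact: continuous_det.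
    exact: sqrt_continuous.
  - by rewrite Tx /density /= chart_mapK.
  - by apply: filterS fT => v vT /vT; rewrite /density /= => ->.
have [S [cS Sx fS]] := smooth_on_local (mu_smooth ac) cx.
have b2 : \forall v \near c x, (c @` chart_dom c) v ->
    mu x / 2 <= mu (chart_inv c v) <= mu x + 1.
  apply: (@chart_local_bounds c x mu S) => //.
  by rewrite Sx /= chart_mapK.
have inN : \forall v \near c x, (c @` chart_dom c) v -> N (chart_inv c v).
  have /subspace_continuousP := @chart_inv_continuous _ _ _ c.
  move=> /(_ _ cx) H; have := H N; rewrite /= /from_subspace chart_mapK//.
  by move=> /(_ Nx).
have hI := chart_image_ball dx.
have /nbhs_ballP[r /= r0 rP] : \forall v \near c x, half_space v ->
    [/\ (c @` chart_dom c) v, N (chart_inv c v),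
     density c x / 2 <= density c (chart_inv c v) <= density c x + 1 &
     mu x / 2 <= mu (chart_inv c v) <= mu x + 1].
  near=> v => hv; have cv : (c @` chart_dom c) v by move: hv; near: v.
  by split => //; move: cv; near: v.
exists r, (Num.min (density c x / 2) (mu x / 2)), (Num.max (density c x + 1) (mu x + 1)).
have mx := mu_gt0 x.
split=> //; first by rewrite lt_min !divr_gt0.
  by rewrite lt_max addr_gt0.
move=> v bv hv; have [cv nv /andP[d1 d2] /andP[m1 m2]] := rP v bv hv.
by split=> //; rewrite ge_min le_max ?d1 ?d2 ?m1 ?m2 ?orbT.
Unshelve. all: by end_near.
Qed.

(** In a small chart neighbourhood the density and the weight lie between positive constants, so the
    measure compares with the Lebesgue measure of two balls: one containing the image of [W] and one
    inside it. *)
Lemma weighted_measure_nbhs x (N : set M) : nbhs x N ->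
  exists W : set M, [/\ open W, W x, W `<=` N,
    (0 < weighted_measure V mu W)%E & (weighted_measure V mu W < +oo)%E].
Proof.
move=> Nx; have [ac dx] := chart_atP X x; set c := chart_at X x in ac dx.
have [r [d [B [r0 d0 B0 rP]]]] := chart_density_bounds ac dx Nx.
pose W := chart_dom c `&` c @^-1` ball (c x) r.
have oW : open W.
  have oc := chart_dom_open c.
  have /(continuous_inP c oc) : {in chart_dom c, continuous c}.
    by rewrite -continuous_open_subspace//; exact: chart_map_continuous.
  by apply; exact: ball_open.
have mW := measurable_open oW.
have WP p : W p -> [/\ N p, d <= density c p <= B & d <= mu p <= B].
  move=> [dp bp]; have := rP _ bp (chart_image_half_space dp).
  by rewrite chart_mapK// => -[].
have VW : V W = (\int[@lebesgue_rV R n]_(v in (c @` W : set (borel_rV R n)))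
    (density c (chart_inv c v))%:E)%E by apply: V_volume => // p [].
(* The point [c x] may lie on the boundary hyperplane. Shifting every coordinate by [r / 2] gives a
   cube with coordinates between those of [c x] and those plus [r], hence inside the half space. *)
have [b bP] : exists b, forall v, ball b (r / 2) v -> ball (c x) r v /\ half_space v.
  exists (c x + const_mx (r / 2)) => v [_ bv].
  have bi i : c x 0 i < v 0 i < c x 0 i + r.
    by have := bv 0 i; rewrite /ball /= !mxE ltr_distlC; lra.
  split.
    split=> // i j; rewrite (ord1 i) /ball /= ltr_distlC.
    by have /andP[? ?] := bi j; apply/andP; split; lra.
  move=> i i0; have := chart_image_half_space dx i0.
  by have /andP[? ?] := bi i; lra.
have r20 : 0 < r / 2 by rewrite divr_gt0.
have VW0 : (0 < V W)%E.
  rewrite VW; apply: (@lt_le_trans _ _ (\int[@lebesgue_rV R n]_(v in (ball b (r / 2) : set (borel_rV R n))) cst d%:E v)%E).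
    rewrite integral_cst; last exact: measurable_ball_rV.
    by rewrite mule_gt0 ?lte_fin//; have /andP[] := lebesgue_rV_ball b r20.
  apply: lower_integral_mono => v; first by rewrite lee_fin ltW.
    by rewrite lee_fin sqrtr_ge0.
  move=> /bP[bv hv]; have [cv _ /andP[dv _] _] := rP v bv hv.
  rewrite lee_fin; split => //.
  have [dp cp] := chart_inv_dom cv.
  by exists (chart_inv c v) => //; split => //=; rewrite cp.
have VWy : (V W < +oo)%E.
  rewrite VW; apply: (@le_lt_trans _ _ (\int[@lebesgue_rV R n]_(v in (ball (c x) r : set (borel_rV R n))) cst B%:E v)%E); last first.
    rewrite integral_cst; last exact: measurable_ball_rV.
    by rewrite lte_mul_pinfty ?lee_fin ?ltW//; have /andP[] := lebesgue_rV_ball (c x) r0.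
  apply: lower_integral_mono => v.
  - by rewrite lee_fin sqrtr_ge0.
  - by rewrite lee_fin ltW.
  - move=> [p Wp <-]; have [dp bp] := Wp; rewrite chart_mapK//; split => //.
    by rewrite lee_fin; have [_ /andP[]] := WP _ Wp.
exists W; split => //.
- by split => //; exact: ballxx.
- by move=> p /WP[].
- apply: (@lt_le_trans _ _ (\int[V]_(p in (W : set (borel_space M))) cst d%:E p)%E).
    by rewrite integral_cst// mule_gt0// lte_fin.
  apply: lower_integral_mono => [p _|p _|p Wp]; rewrite lee_fin; [exact: ltW|exact: ltW|].
  by split => //; have [_ _ /andP[]] := WP _ Wp.
- apply: (@le_lt_trans _ _ (\int[V]_(p in (W : set (borel_space M))) cst B%:E p)%E).
    apply: lower_integral_mono => [p _|p _|p Wp]; rewrite lee_fin; [exact: ltW|exact: ltW|].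
    by split => //; have [_ _ /andP[]] := WP _ Wp.
  by rewrite integral_cst// lte_mul_pinfty ?lee_fin ?ltW.
Qed.

Let weight_ge0 (x : borel_space M) : (0 <= (mu x)%:E)%E.
Proof. by rewrite lee_fin ltW. Qed.

(** Finitely many open sets of finite measure cover [M], and the measure is subadditive. *)
Lemma weighted_measure_fin : compact [set: M] -> (weighted_measure V mu setT < +oo)%E.
Proof.
rewrite compact_cover => cM.
have /choice[W WP] (x : M) : exists W : set M,
    [/\ open W, W x & (weighted_measure V mu W < +oo)%E].
  by have [W [? ? _ _ ?]] := weighted_measure_nbhs (@filterT _ (nbhs x) _); exists W.
have [D _ MD] : finite_subset_cover setT W [set: M].
  by apply: cM => [x _|x _]; [case: (WP x)|exists x => //; case: (WP x)].
have : measurable (\big[setU/set0]_(x <- finmap.enum_fset D) W x : set (borel_space M)) /\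
    (weighted_measure V mu (\big[setU/set0]_(x <- finmap.enum_fset D) W x) < +oo)%E.
  apply: (big_ind (fun A : set M => measurable (A : set (borel_space M)) /\
    (weighted_measure V mu A < +oo)%E)).
  - by split => //; rewrite /weighted_measure integral_set0 ltry.
  - move=> A B [mA Ay] [mB By]; split; first exact: measurableU.
    apply: le_lt_trans (lower_integral_setU V mA mB weight_ge0) _.
    exact: lte_add_pinfty.
  - by move=> x _; have [oW _ Wy] := WP x; split => //; exact: measurable_open.
move=> [_]; apply: le_lt_trans; apply: lower_integral_mono => // x _.
by split => //; rewrite -bigcup_fset; have [i iD Wi] := MD x I; exists i.
Qed.

(** The set [A] misses an open set [W] of positive measure. The strict inequality comes from
    additivity over [W] and its complement, the latter having finite measure. *)
Lemma weighted_measure_ltT (x : M) (U A : set M) : compact [set: M] -> nbhs x U ->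
  A `<=` ~` U -> (weighted_measure V mu A < weighted_measure V mu setT)%E.
Proof.
move=> cM Ux AU.
have [W [oW _ WU W0 _]] := weighted_measure_nbhs Ux.
have mW := measurable_open oW.
have mWC : measurable (~` W : set (borel_space M)) by exact: measurableC.
have WA : (weighted_measure V mu A <= weighted_measure V mu (~` W))%E.
  by apply: lower_integral_mono => // y /AU Uy; split => // /WU.
apply: le_lt_trans WA _.
have -> : weighted_measure V mu setT =
    (weighted_measure V mu (~` W) + weighted_measure V mu W)%E.
  rewrite /weighted_measure -[setT](_ : ~` W `|` W = _); last exact: setUCl.
  rewrite ge0_integral_setU//.
  - by apply/measurable_EFinP; apply: measurable_funTS; exact: measurable_weight.
  - by apply/disj_setPS => y [].
rewrite lteDl// ge0_fin_numE; last exact: integral_ge0.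
apply: le_lt_trans (weighted_measure_fin cM).
exact: lower_integral_mono.
Qed.

End weighted_measure.

(** * The topology of the space of boundary functions *)

Section boundary_topology.
Variables (R : realType) (n : nat) (M : ptopologicalType) (X : smooth_manifold R n M).
Implicit Types tau sigma : boundary_functions X.

(** Neighbourhoods for uniform convergence come from entourages of [R], each of which contains the
    pairs at distance less than some [e]. *)
Lemma nbhs_boundary_functions tau (A : set (boundary_functions X)) :
  nbhs tau A <-> exists2 e : R, 0 < e & forall sigma,
    (forall y, `|eval_boundary tau y - eval_boundary sigma y| < e) -> A sigma.
Proof.
split.
  move=> [_ [[B oB <-] Btau BA]].
  have /uniform_nbhs[E [entE EB]] :
      nbhs (eval_boundary tau : {uniform boundary X -> R}) B.
    exact: open_nbhs_nbhs.
  have [e e0 eE] : exists2 e : R, 0 < e & (forall a b : R, ball a e b -> E (a, b)).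
    by move: entE; rewrite -entourage_ballE => -[e /= e0 eE]; exists e => // a b ab; exact: (eE (a, b)).
  exists e => // sigma ts; apply: BA; apply: EB => y _; apply: eE.
  exact: ts.
move=> [e e0 eA].
have := @initial_continuous _ _
  (id : continuousType (boundary X) R -> {uniform boundary X -> R}) tau.
move=> /(_ [set h | forall y, [set: boundary X] y ->
   [set p : R * R | ball p.1 e p.2] (eval_boundary tau y, h y)]).
rewrite nbhs_simpl /= => H; apply: filterS (H _).
  by move=> sigma /= h; apply: eA => y; exact: h.
apply/uniform_nbhs; exists [set p : R * R | ball p.1 e p.2]; split => //.
exact: entourage_ball (PosNum e0).
Qed.

Lemma boundary_functions_shift tau (e : R) : exists sigma,
  forall y, eval_boundary sigma y = eval_boundary tau y - e.
Proof.
have ct : continuous (fun y : boundary X => eval_boundary tau y - e).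
  have ctau : continuous (eval_boundary tau).
    exact: (@cts_fun _ _ (tau : continuousType (boundary X) R)).
  by move=> y; apply: cvgB; [exact: nbhs_filter|exact: ctau|apply: cvg_cst; exact: nbhs_filter].
by exists (mkcts ct : continuousType (boundary X) R).
Qed.

End boundary_topology.

(** * A uniform margin for covering domains of influence *)

Section influence_domain.
Variables (R : realType) (n : nat) (M : ptopologicalType) (X : smooth_manifold R n M).
Variable g : riemannian_metric X.
Implicit Types tau sigma : boundary_functions X.

(** Each [x] has a neighbourhood on which one boundary point works for all small margins;
    compactness, in the form of near coverings, gives a margin common to all points. *)
Lemma influence_open_margin tau : compact [set: M] -> influence_open g tau = setT ->
  exists2 e : R, 0 < e & forall x, exists y : boundary X,
    (riemannian_dist g x (val y) < (eval_boundary tau y - e)%:E)%E.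
Proof.
move=> /compact_near_coveringP cM tauT.
have : \forall e \near (0 : R)^'+, [set: M] `<=` (fun x => exists y : boundary X,
    (riemannian_dist g x (val y) < (eval_boundary tau y - e)%:E)%E).
  apply: cM => x _.
  have [y dxy] : influence_open g tau x by rewrite tauT.
  have [e e0 dxye] : exists2 e : R, 0 < e &
      (riemannian_dist g x (val y) < (eval_boundary tau y - e)%:E)%E.
    move: dxy (riemannian_dist_ge0 g x (val y)).
    case: riemannian_dist => // r; rewrite lte_fin => rt _.
    exists ((eval_boundary tau y - r) / 2); first by rewrite divr_gt0// subr_gt0.
    by rewrite lte_fin; lra.
  have e20 : 0 < e / 2 by rewrite divr_gt0.
  (* Half of the margin [e] at [x] pays for the move from [x'] to [x]; the other half is left for
     [d]. *)
  exists ([set x' | (riemannian_dist g x' x < (e / 2)%:E)%E], [set d | d < e / 2]).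
    split; last exact: nbhs_right_lt.
    by apply: filterS (riemannian_dist_near g x e20) => z [].
  move=> [x' d] [/= dx' de]; exists y.
  apply: lt_le_trans (riemannian_dist_lt_add dx' dxye) _.
  by rewrite lee_fin; lra.
move=> H; have [e [/= e0 eP]] : exists e : R, 0 < e /\ [set: M] `<=` (fun x => exists y : boundary X,
    (riemannian_dist g x (val y) < (eval_boundary tau y - e)%:E)%E).
  have P : ProperFilter (0 : R)^'+ by exact: at_right_proper_filter.
  by apply: (@filter_ex _ _ P); near=> e; split; near: e => //; exact: nbhs_right_gt.
by exists e => // x; exact: eP.
Unshelve. all: by end_near.
Qed.

End influence_domain.

(** * The closure of [Q_set] *)

Section closure.
Variables (R : realType) (n : nat) (M : ptopologicalType) (X : smooth_manifold R n M).
Variable g : riemannian_metric X.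

(** The measure enters only through the strict inequality for sets that miss a neighbourhood of a
    point. *)
Lemma Q_tilde_closure (V : {measure set (borel_space M) -> \bar R}) (mu : M -> R) :
  compact [set: M] ->
  (forall (x : M) (U A : set M), nbhs x U -> A `<=` ~` U ->
     (weighted_measure V mu A < weighted_measure V mu setT)%E) ->
  Q_tilde g = closure (Q_set g V mu).
Proof.
move=> cM ltm; apply/seteqP; split => tau.
  move=> [x nx] B /nbhs_boundary_functions[e e0 eB].
  have [sigma sE] := boundary_functions_shift tau (e / 2).
  have e20 : 0 < e / 2 by rewrite divr_gt0.
  exists sigma; split; last first.
    by apply: eB => y; rewrite sE opprB addrC subrK gtr0_norm//; lra.
  have e40 : 0 < e / 4 by rewrite divr_gt0.
  apply: (ltm x [set z | (riemannian_dist g x z < (e / 4)%:E)%E]).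
    by apply: filterS (riemannian_dist_near g x e40) => z [].
  (* A common point [z] would give [riemannian_dist g x (val y)] less than [e / 4] plus
     [tau y - e / 4], contradicting the choice of [x]. *)
  move=> z [y]; rewrite sE => zy /= xz; apply: nx; exists y.
  have {}zy : (riemannian_dist g z (val y) < (eval_boundary tau y - e / 4)%:E)%E.
    by apply: le_lt_trans zy _; rewrite lte_fin; lra.
  apply: lt_le_trans (riemannian_dist_lt_add xz zy) _.
  by rewrite lee_fin; lra.
move=> ctau; apply/set0P/eqP => Q0.
have tauT : influence_open g tau = setT by rewrite -[LHS]setCK Q0 setC0.
have [e e0 eP] := influence_open_margin cM tauT.
have /ctau[sigma [Qs es]] : nbhs tau [set sigma : boundary_functions X |
    forall y, `|eval_boundary tau y - eval_boundary sigma y| < e].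
  by apply/nbhs_boundary_functions; exists e.
(* Since [sigma] exceeds [tau - e] on the boundary, its closed domain of influence is all of [M], so
   [sigma] cannot be in [Q_set]. *)
move: Qs; rewrite /Q_set /= (_ : influence_closed g sigma = setT) ?ltxx//.
apply/seteqP; split => // x _; have [y xy] := eP x; exists y.
apply: ltW; apply: lt_trans xy _; rewrite lte_fin.
by have := es y; rewrite ltr_norml => /andP[_]; lra.
Qed.

End closure.

Theorem lemma7 (R : realType) (n : nat) (n_ge2 : (2 <= n)%N)
    (M : ptopologicalType) (X : smooth_manifold R n M)
    (g : riemannian_metric X)
    (M_compact : compact [set: M]) (M_connected : connected [set: M])
    (boundary_neq0 : boundary X !=set0)
    (V : {measure set (borel_space M) -> \bar R})
    (V_volume : is_riemannian_volume g V)
    (mu : M -> R) (mu_smooth : smooth_function X mu)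
    (mu_gt0 : forall x, 0 < mu x) :
  Q_tilde g = closure (Q_set g V mu).
Proof.
apply: Q_tilde_closure => // x U A.
exact: (weighted_measure_ltT V_volume mu_smooth mu_gt0).
Qed.
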